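(* Let $g:\mathbb{R}^n\to\mathbb{R}^m$ be twice continuously differentiable, $\Lambda\subseteq\mathbb{R}^m$ closed, $\mathcal F:=\{x:g(x)\in\Lambda\}$ and $\bar x\in\mathcal F$. Suppose that the set-valued map $M(x):=g(x)-\Lambda$ is metrically subregular at $(\bar x,0)$ in direction $d\in\mathbb{R}^n$ with modulus $\kappa$. Then $$d\in T_{\mathcal F}(\bar x)\iff\nabla g(\bar x)d\in T_\Lambda(g(\bar x)),$$ and if $d$ satisfies $\nabla g(\bar x)d\in T_\Lambda(g(\bar x))$, then $$T^2_{\mathcal F}(\bar x;d)=\{w:\nabla g(\bar x)w+\nabla^2g(\bar x)(d,d)\in T^2_\Lambda(g(\bar x);\nabla g(\bar x)d)\}=D^2M(\bar x,0;d)^{-1}(0).$$ Moreover, for all $w\in\mathbb{R}^n$, $$\mathrm{dist}(w,T^2_{\mathcal F}(\bar x;d))\le\kappa\,\mathrm{dist}\big(\nabla g(\bar x)w+\nabla^2g(\bar x)(d,d),\,T^2_\Lambda(g(\bar x);\nabla g(\bar x)d)\big)=\kappa\,\mathrm{dist}\big(0,D^2M(\bar x,0;d)(w)\big).$$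
   Context: $\nabla g(x)\in\mathbb{R}^{m\times n}$ is the Jacobian and $\nabla^2 g(x)(d,d):=(d^T\nabla^2 g_1(x)d,\dots,d^T\nabla^2 g_m(x)d)^T$. For $x\in S$, $T_S(x):=\{d: \exists t_k\downarrow0,\ d_k\to d,\ x+t_kd_k\in S\}$; for $d\in T_S(x)$, $T^2_S(x;d):=\{w:\exists t_k\downarrow 0,\ w_k\to w,\ x+t_kd+\tfrac12t_k^2w_k\in S\}$. The second-order linearized mapping is $D^2M(\bar x,0;d)(w):=\nabla g(\bar x)w+\nabla^2g(\bar x)(d,d)-T^2_\Lambda(g(\bar x);\nabla g(\bar x)d)$. $M(x)=g(x)-\Lambda$ is metrically subregular at $(\bar x,0)$ in direction $d$ if there are $\kappa',\rho,\delta>0$ with $\mathrm{dist}(x,\mathcal F)\le\kappa'\,\mathrm{dist}(g(x),\Lambda)$ for all $x\in\bar x+V_{\rho,\delta}(d)$, where $V_{\rho,\delta}(d):=\{w:\|w\|<\rho,\ \big\|\,\|d\|w-\|w\|d\,\big\|\le\delta\|w\|\|d\|\}$. The modulus is the infimum of $\kappa'$ over all such combinations $(\kappa',\rho,\delta)$. The distance to the empty set is $+\infty$. The second-order objects in the ''Moreover'' part are considered for $d$ with $\nabla g(\bar x)d\in T_\Lambda(g(\bar x))$. *)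

(* Defs.v *)
From HB Require Import structures.
From mathcomp Require Import all_boot all_order all_algebra.
From mathcomp Require Import all_classical all_reals all_analysis.

Set Implicit Arguments.
Unset Strict Implicit.
Unset Printing Implicit Defensive.

Import Order.TTheory GRing.Theory Num.Theory.
Import numFieldNormedType.Exports.

Local Open Scope classical_set_scope.
Local Open Scope ring_scope.

(* R^n is 'rV[R]_n.  The library norm on 'rV[R]_n is the sup norm; it is used
   only through the topology it induces (limits, closedness, derivatives), and
   every metric quantity is Euclidean, since the modulus of subregularity
   depends on the norm. *)
Definition enorm (R : realType) (n : nat) (v : 'rV[R]_n) : R :=
  Num.sqrt (\sum_(i < n) v 0 i ^+ 2).

(* Extended-real valued, so that the distance to the empty set is +oo. *)
Definition dist (R : realType) (n : nat) (x : 'rV[R]_n) (S : set 'rV[R]_n) :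
    \bar R :=
  ereal_inf [set (enorm (x - y))%:E | y in S].

(* [jacobian g x] acts on row vectors from the right: it is the transpose of
   the usual m x n Jacobian matrix. *)
Definition grad_app (R : realType) (n m : nat) (g : 'rV[R]_n -> 'rV[R]_m)
    (x w : 'rV[R]_n) : 'rV[R]_m :=
  w *m jacobian g x.

Definition hessian (R : realType) (n : nat) (f : 'rV[R]_n -> R)
    (x : 'rV[R]_n) : 'M[R]_n :=
  \matrix_(j < n, k < n)
    'D_(delta_mx 0 j) (fun y => 'D_(delta_mx 0 k) f y) x.

Definition hess_app (R : realType) (n m : nat) (g : 'rV[R]_n -> 'rV[R]_m)
    (x d : 'rV[R]_n) : 'rV[R]_m :=
  \row_(i < m) (d *m hessian (fun y => g y 0 i) x *m d^T) 0 0.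

(* In finite dimension the pointwise continuity in the last clause is
   continuity of the second derivative as an operator-valued map. *)
Definition twice_continuously_differentiable (R : realType) (n m : nat)
    (g : 'rV[R]_n -> 'rV[R]_m) : Prop :=
  [/\ forall x, differentiable g x,
      forall x, differentiable (jacobian g) x &
      forall v, continuous (fun x => 'D_v (jacobian g) x)].

Definition feasible_set (R : realType) (n m : nat) (g : 'rV[R]_n -> 'rV[R]_m)
    (Lam : set 'rV[R]_m) : set 'rV[R]_n :=
  [set x | Lam (g x)].

Definition tangent_cone (R : realType) (n : nat) (S : set 'rV[R]_n)
    (x : 'rV[R]_n) : set 'rV[R]_n :=
  [set d | exists (t : nat -> R) (dk : nat -> 'rV[R]_n),
    [/\ forall k, 0 < t k, t @ \oo --> (0 : R), dk @ \oo --> d &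
        forall k, S (x + t k *: dk k)]].

Definition tangent_set2 (R : realType) (n : nat) (S : set 'rV[R]_n)
    (x d : 'rV[R]_n) : set 'rV[R]_n :=
  [set w | exists (t : nat -> R) (wk : nat -> 'rV[R]_n),
    [/\ forall k, 0 < t k, t @ \oo --> (0 : R), wk @ \oo --> w &
        forall k, S (x + t k *: d + (2^-1 * t k ^+ 2) *: wk k)]].

Definition dir_nbhd (R : realType) (n : nat) (rho delta : R) (d : 'rV[R]_n) :
    set 'rV[R]_n :=
  [set w | enorm w < rho /\
    enorm (enorm d *: w - enorm w *: d) <= delta * enorm w * enorm d].

(* [subregularity_constant g Lam xbar d k]: some rho, delta > 0 make the
   subregularity estimate of x |-> g x - Lam at (xbar, 0) in direction d hold
   with the constant k. *)
Definition subregularity_constant (R : realType) (n m : nat)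
    (g : 'rV[R]_n -> 'rV[R]_m) (Lam : set 'rV[R]_m) (xbar d : 'rV[R]_n)
    (k : R) : Prop :=
  0 < k /\ exists rho delta : R,
    [/\ 0 < rho, 0 < delta &
        forall v, dir_nbhd rho delta d v ->
          (dist (xbar + v)%R (feasible_set g Lam)
            <= k%:E * dist (g (xbar + v)%R) Lam)%E].

Definition metrically_subregular (R : realType) (n m : nat)
    (g : 'rV[R]_n -> 'rV[R]_m) (Lam : set 'rV[R]_m) (xbar d : 'rV[R]_n) : Prop :=
  exists k, subregularity_constant g Lam xbar d k.

Definition subregularity_modulus (R : realType) (n m : nat)
    (g : 'rV[R]_n -> 'rV[R]_m) (Lam : set 'rV[R]_m) (xbar d : 'rV[R]_n) : R :=
  inf [set k | subregularity_constant g Lam xbar d k].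

Definition D2M (R : realType) (n m : nat) (g : 'rV[R]_n -> 'rV[R]_m)
    (Lam : set 'rV[R]_m) (xbar d w : 'rV[R]_n) : set 'rV[R]_m :=
  [set grad_app g xbar w + hess_app g xbar d - z
    | z in tangent_set2 Lam (g xbar) (grad_app g xbar d)].

Definition setmap_inv (T U : Type) (F : T -> set U) (u : U) : set T :=
  [set x | F x u].

(* Main.v *)
Require Import Defs.
From mathcomp Require Import all_boot all_order all_algebra.
From mathcomp Require Import all_classical all_reals all_analysis.
From mathcomp Require Import ring lra.
Import Order.TTheory GRing.Theory Num.Theory.
Import numFieldNormedType.Exports.
Local Open Scope classical_set_scope.
Local Open Scope ring_scope.

(** The inclusions from F to Lam are chain rules: the Taylor expansion of g at
    xbar sends a sequence realising a (second-order) tangent direction of F to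
    one realising its image direction for Lam ([tangent_cone_sub],
    [tangent_set2_sub]).

    Subregularity gives the converse, together with the distance estimate.  Let
    z be a second-order tangent of Lam, realised by t_k and z_k, let w be
    arbitrary, and follow the parabola x_k = xbar + t_k d + (t_k^2/2) w.  It
    leaves xbar in direction d, so it ends up in the directional neighbourhood
    where the subregularity estimate holds, and F contains a point y_k whose
    distance to x_k is, up to a slack o(t_k^2), at most k times the distance from
    g(x_k) to the point of Lam given by z_k.  Divided by t_k^2/2 that bound tends to
    k |Dg w + D^2g(d,d) - z|, again by Taylor's formula.  The rescaled points
    2 (y_k - xbar - t_k d) / t_k^2 are therefore bounded, and by compactness
    they accumulate at some v in the second-order tangent set of F with
    |w - v| <= k |Dg w + D^2g(d,d) - z| ([tangent_set2_lift]).  Taking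
    z = Dg w + D^2g(d,d) forces v = w, which is the missing inclusion; taking
    infima over z and over the constants k gives the estimate with the modulus.

    The infimum over the constants needs care when the modulus is 0 and the
    tangent set of Lam could be empty, since 0 times +oo is 0 whereas the
    distance to an empty set is +oo.  This does not happen: g is Lipschitz near
    xbar, so an estimate whose constant is small compared with the Lipschitz
    constant is self-improving, dist(x, F) <= dist(x, F) / 2 up to an arbitrarily
    small error.  The ray xbar + t d then lies at distance 0 from F, and both
    second-order tangent sets are nonempty ([small_constant_tangent_set2]). *)

(** * Sup norm, limits and products of matrices *)

Lemma mx_entry_le_norm {R : realType} {m n : nat} (A : 'M[R]_(m, n)) i j :
  `|A i j| <= `|A|.
Proof.
by rewrite [leRHS]/Num.norm /= mx_normrE; apply/bigmax_geP; right; exists (i, j).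
Qed.

Lemma mx_norm_le_entries {R : realType} {m n : nat} (A : 'M[R]_(m, n)) (c : R) :
  0 <= c -> (forall i j, `|A i j| <= c) -> `|A| <= c.
Proof.
move=> c0 Ac; rewrite [leLHS]/Num.norm /= mx_normrE.
by apply/bigmax_leP; split => // -[i j] _; exact: Ac.
Qed.

Lemma norm_mulmx_le {R : realType} {n m : nat} (v : 'rV[R]_n)
    (A : 'M[R]_(n, m)) :
  `|v *m A| <= n%:R * (`|v| * `|A|).
Proof.
apply: mx_norm_le_entries => [|i j]; first by rewrite mulr_ge0 ?mulr_ge0.
rewrite mxE (le_trans (ler_norm_sum _ _ _))//.
rewrite (@le_trans _ _ (\sum_(k < n) `|v| * `|A|)) //.
  by apply: ler_sum => k _; rewrite normrM ler_pM ?mx_entry_le_norm.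
by rewrite sumr_const card_ord mulr_natl.
Qed.

Lemma cvg_mx {R : realType} {T : Type} {F : set_system T} {FF : Filter F}
    {m n : nat} (f : T -> 'M[R]_(m, n)) (A : 'M[R]_(m, n)) :
  (forall i j, f x i j @[x --> F] --> A i j) -> f @ F --> A.
Proof.
move=> fA; apply/cvgrPdist_le => e e0; near=> x.
apply: mx_norm_le_entries => [|i j]; first exact: ltW.
rewrite !mxE; move: i j; near: x; do 2![apply: filter_forall => ?].
exact: (cvgrPdist_le _ _).1 (fA _ _) e e0.
Unshelve. all: by end_near. Qed.

Lemma cvg_entry {R : realType} {T : Type} {F : set_system T} {FF : Filter F}
    {m n : nat} {f : T -> 'M[R]_(m, n)} {A : 'M[R]_(m, n)} (i : 'I_m) (j : 'I_n) :
  f @ F --> A -> f x i j @[x --> F] --> A i j.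
Proof.
move=> fA; apply: (@cvg_comp _ _ _ f (fun M => M i j) _ _ _ fA).
exact: (@coord_continuous _ _ _ i j A).
Qed.

Lemma cvg_mulmx {R : realType} {T : Type} {F : set_system T} {FF : Filter F}
    {m n p : nat} {f : T -> 'M[R]_(m, n)} {h : T -> 'M[R]_(n, p)}
    {A : 'M[R]_(m, n)} {B : 'M[R]_(n, p)} :
  f @ F --> A -> h @ F --> B -> f x *m h x @[x --> F] --> A *m B.
Proof.
move=> fA hB; apply: cvg_mx => i j; rewrite mxE.
under eq_fun do rewrite mxE.
apply: cvg_big => [|k _]; first exact: add_continuous.
apply: cvgM.
- exact: cvg_entry fA.
- exact: cvg_entry hB.
Qed.

(** * First and second order expansions *)

Lemma diff_jacobian {R : realType} {n m : nat} {g : 'rV[R]_n -> 'rV[R]_m} {x}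
    (h : 'rV[R]_n) : differentiable g x -> 'd g x h = h *m jacobian g x.
Proof. by move=> dg; rewrite -deriveE// deriveEjacobian. Qed.

Lemma is_derive_along {R : realType} {n m : nat} {g : 'rV[R]_n -> 'rV[R]_m}
    {x h : 'rV[R]_n} {s : R} (i : 'I_m) : differentiable g (x + s *: h) ->
  is_derive s 1 (fun s => g (x + s *: h) 0 i) ((h *m jacobian g (x + s *: h)) 0 i).
Proof.
move=> dg.
have dl : is_diff s (cst x + *:%R ^~ h) (0 + *:%R ^~ h) by exact: is_diffD.
have dgl := is_diff_comp dl (differentiableP dg).
have dgl1 : differentiable (g \o (cst x + *:%R ^~ h)) s by case: dgl.
have dgl2 : derivable (g \o (cst x + *:%R ^~ h)) s 1 by exact: diff_derivable.
apply: DeriveDef.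
  by have /derivable_mxP/(_ 0 i) := dgl2.
have := deriveE (1 : R^o) dgl1.
rewrite derive_mx// diff_val /= add0r scale1r diff_jacobian// => /matrixP/(_ 0 i).
by rewrite mxE.
Qed.

(** One scalar mean value theorem serves twice: with B = 0 it gives the local
    Lipschitz estimate, with B the derivative of the Jacobian in direction h it
    gives the second-order expansion.  The mean value c depends on the entry i,
    so no vector-valued version can hold. *)
Lemma taylor_entry {R : realType} {n m : nat} {g : 'rV[R]_n -> 'rV[R]_m}
    (x h : 'rV[R]_n) (B : 'M[R]_(n, m)) (i : 'I_m) :
  (forall y, differentiable g y) ->
  exists2 c : R, 0 <= c <= 1 &
    (g (x + h) - g x - h *m jacobian g x - 2^-1 *: (h *m B)) 0 i
    = (h *m (jacobian g (x + c *: h) - jacobian g x - c *: B)) 0 i.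
Proof.
move=> dg.
pose a := (h *m jacobian g x) 0 i; pose b := (h *m B) 0 i.
pose psi := (fun s : R => g (x + s *: h) 0 i - a * s - (2^-1 * b) * s ^+ 2).
have dpsi (s : R) : is_derive s 1 psi
    ((h *m jacobian g (x + s *: h)) 0 i - a - b * s).
  have := is_derive_along (x := x) (h := h) i (dg (x + s *: h)) => ?.
  rewrite /psi; apply: is_derive_eq.
  rewrite /GRing.scale /=; by field.
have [c] := MVT_segment ler01 (fun s _ => dpsi s)
  (derivable_within_continuous (fun s _ => @ex_derive _ _ _ _ _ _ _ (dpsi s))).
rewrite in_itv /= => c01 psi01; exists c => //; move: psi01.
rewrite /psi scale0r scale1r addr0 !mulmxBr -scalemxAr.
have mxBE (u v : 'rV[R]_m) : (u - v) 0 i = u 0 i - v 0 i by rewrite !mxE.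
have mxZE t (u : 'rV[R]_m) : (t *: u) 0 i = t * u 0 i by rewrite !mxE.
rewrite 5!mxBE 2!mxZE /a /b expr1n expr0n /= !mulr0 !mulr1 !subr0.
rewrite mulr1 [_ * c]mulrC => <-.
by rewrite [RHS]addrAC; congr (_ - _); exact: addrAC.
Qed.

(** The remainder is h applied to the first-order remainder of the Jacobian at
    c h, which is o(|h|) uniformly in c because |c h| <= |h|. *)
Lemma taylor_peano {R : realType} {n m : nat} {g : 'rV[R]_n -> 'rV[R]_m}
    {x : 'rV[R]_n} (e : R) :
  (forall y, differentiable g y) -> differentiable (jacobian g) x -> 0 < e ->
  \forall h \near (0 : 'rV[R]_n),
    `|g (x + h) - g x - h *m jacobian g x
      - 2^-1 *: (h *m 'd (jacobian g) x h)| <= e * `|h| ^+ 2.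
Proof.
move=> dg dJ e0.
have n1 : 0 < n.+1%:R :> R by rewrite ltr0n.
have := diff_locally dJ; move=> /eqaddoP => /(_ _ (divr_gt0 e0 n1)).
move=> /nbhs_ballP[r /= r0 Hr].
have {}Hr k : `|k| < r -> `|jacobian g (x + k) - jacobian g x
    - 'd (jacobian g) x k| <= e / n.+1%:R * `|k|.
  move=> kr; have /Hr : ball 0 r k by rewrite -ball_normE /= sub0r normrN.
  by rewrite -addrA -opprD [x + k]addrC.
apply/nbhs_ballP; exists r => //= h; rewrite -ball_normE /= sub0r normrN => hr.
apply: mx_norm_le_entries => [|j i]; first by rewrite mulr_ge0 ?sqr_ge0 ?ltW.
rewrite [j]ord1.
have [c /andP[c0 c1] ->] := taylor_entry x h ('d (jacobian g) x h) i dg.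
rewrite (le_trans (mx_entry_le_norm _ _ _))// (le_trans (norm_mulmx_le _ _))//.
have ch : `|c *: h| <= `|h|.
  by rewrite normrZ ger0_norm// ler_piMl.
have := Hr _ (le_lt_trans ch hr); rewrite linearZ /= => Hc.
rewrite (@le_trans _ _ (n%:R * (`|h| * (e / n.+1%:R * `|h|))))//.
  rewrite ler_wpM2l// ler_wpM2l// (le_trans Hc)//.
  by rewrite ler_wpM2l// ltW// divr_gt0.
(* The factor n comes from [norm_mulmx_le]; the tolerance was divided by n + 1
   rather than n so that n = 0 needs no separate case. *)
rewrite [leLHS](_ : _ = (n%:R / n.+1%:R) * (e * `|h| ^+ 2)); last by ring.
by rewrite ler_piMl ?mulr_ge0 ?sqr_ge0 ?(ltW e0)// ler_pdivrMr// mul1r ler_nat.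
Qed.

Lemma locally_lipschitz {R : realType} {n m : nat} {g : 'rV[R]_n -> 'rV[R]_m}
    {x : 'rV[R]_n} :
  (forall y, differentiable g y) -> {for x, continuous (jacobian g)} ->
  exists2 r : R, 0 < r & exists2 L : R, 0 < L &
    forall y z, `|y - x| < r -> `|z - x| < r -> `|g y - g z| <= L * `|y - z|.
Proof.
move=> dg /cvgrPdist_le/(_ 1 ltr01)/nbhs_ballP[r /= r0 Hr].
pose L := n.+1%:R * (`|jacobian g x| + 1).
have L0 : 0 < L by rewrite mulr_gt0 ?ltr0n// ltr_wpDl.
exists r => //; exists L => // y z yx zx.
apply: mx_norm_le_entries => [|j i]; first by rewrite mulr_ge0 ?(ltW L0).
rewrite [j]ord1.
have [c /andP[c0 c1]] := taylor_entry z (y - z) 0 i dg.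
rewrite mulmx0 !scaler0 !subr0 mulmxBr [z + (y - z)]addrC subrK.
have mxBE (u v : 'rV[R]_m) : (u - v) 0 i = u 0 i - v 0 i by rewrite !mxE.
rewrite mxBE [RHS]mxBE => /addIr ->.
rewrite (le_trans (mx_entry_le_norm _ _ _))// (le_trans (norm_mulmx_le _ _))//.
rewrite mulrCA mulrC; apply: ler_wpM2r => //.
rewrite ler_pM// ?ler_nat// -[jacobian g (z + _)](subKr (jacobian g x)).
rewrite (le_trans (ler_normB _ _))// lerD2l.
apply: Hr; rewrite -ball_normE /=.
(* Balls are convex. *)
have -> : x - (z + c *: (y - z)) = c *: (x - y) + (1 - c) *: (x - z).
  by apply/rowP => k; rewrite !mxE; ring.
rewrite (le_lt_trans (ler_normD _ _))// !normrZ ger0_norm// ger0_norm ?subr_ge0//.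
rewrite ![`|x - _|]distrC.
have [->|c_neq1] := eqVneq c 1; first by rewrite subrr mul0r addr0 mul1r.
have : c * `|y - x| + (1 - c) * `|z - x| < c * r + (1 - c) * r.
  rewrite ler_ltD// ?ler_wpM2l ?(ltW yx)// ltr_pM2l// subr_gt0 lt_neqAle.
  exact/andP.
by rewrite -mulrDl [c + _]addrC subrK mul1r.
Qed.

(** The entries of the Hessian matrices are the partial derivatives of the
    entries of the Jacobian, so D^2g(d,d) is the derivative of the Jacobian in
    direction d, applied to d: the form in which Taylor's formula produces it. *)
Lemma hess_app_diff {R : realType} {n m : nat} (g : 'rV[R]_n -> 'rV[R]_m)
    (x d : 'rV[R]_n) :
  (forall y, differentiable g y) -> differentiable (jacobian g) x ->
  hess_app g x d = d *m 'd (jacobian g) x d.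
Proof.
move=> dg dJ; apply/rowP => i; rewrite mxE.
have partialE k : (fun y => 'D_(delta_mx 0 k) (fun z => g z 0 i) y)
    = (fun y => jacobian g y k i).
  apply/funext => y.
  have := deriveEjacobian (delta_mx 0 k) (dg y).
  rewrite derive_mx; last exact: diff_derivable.
  by move/matrixP/(_ 0 i); rewrite mxE -rowE mxE.
have hessE j k : hessian (fun y => g y 0 i) x j k
    = 'd (jacobian g) x (delta_mx 0 j) k i.
  rewrite mxE partialE -(deriveE _ dJ) derive_mx ?mxE//.
  exact: diff_derivable.
rewrite !mxE; apply: eq_bigr => k _; rewrite mulrC !mxE; congr (_ * _).
rewrite [in RHS](row_sum_delta d) linear_sum summxE; apply: eq_bigr => j _.
by rewrite linearZ hessE !mxE.
Qed.

(** * Sequential limit sets *)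

(** Both tangent sets are sequential limit sets of this kind, with P t v saying
    that the point of parameter t in direction v belongs to the set; so a
    tangent direction is exhibited by one approximation per tolerance, and no
    sequence has to be carried along. *)
Lemma seq_limit_intro {R : realType} {n : nat} (P : R -> 'rV[R]_n -> Prop)
    (v : 'rV[R]_n) :
  (forall e : R, 0 < e -> exists (t : R) (u : 'rV[R]_n),
    [/\ 0 < t < e, `|v - u| < e & P t u]) ->
  exists (t : nat -> R) (vk : nat -> 'rV[R]_n),
    [/\ forall k, 0 < t k, t @ \oo --> (0 : R), vk @ \oo --> v &
        forall k, P (t k) (vk k)].
Proof.
move=> H.
have /choice[tv Htv] (k : nat) : exists tu : R * 'rV[R]_n,
    [/\ 0 < tu.1 < k.+1%:R^-1, `|v - tu.2| < k.+1%:R^-1 & P tu.1 tu.2].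
  have [|t [u tu]] := H k.+1%:R^-1; first by rewrite invr_gt0.
  by exists (t, u).
exists (fst \o tv), (snd \o tv); split => [k|||k] /=.
- by have [/andP[]] := Htv k.
- apply/cvgrPdist_lt => e e0; near=> k.
  have [/andP[t0 te] _ _] := Htv k.
  rewrite sub0r normrN gtr0_norm// (lt_trans te)//.
  by near: k; exact: near_infty_natSinv_lt (PosNum e0).
- apply/cvgrPdist_lt => e e0; near=> k.
  have [_ te _] := Htv k.
  rewrite (lt_trans te)//.
  by near: k; exact: near_infty_natSinv_lt (PosNum e0).
- by have [] := Htv k.
Unshelve. all: by end_near. Qed.

(** * Euclidean norm and distance *)

Lemma enorm_ge0 {R : realType} {n : nat} (v : 'rV[R]_n) : 0 <= enorm v.
Proof. exact: sqrtr_ge0. Qed.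

Lemma enormZ {R : realType} {n : nat} (a : R) (v : 'rV[R]_n) :
  enorm (a *: v) = `|a| * enorm v.
Proof.
rewrite /enorm (eq_bigr (fun i => a ^+ 2 * v 0 i ^+ 2)) => [|i _]; last first.
  by rewrite mxE exprMn.
by rewrite -mulr_sumr sqrtrM ?sqr_ge0// sqrtr_sqr.
Qed.

Lemma enormN {R : realType} {n : nat} (v : 'rV[R]_n) : enorm (- v) = enorm v.
Proof. by rewrite -scaleN1r enormZ normrN1 mul1r. Qed.

Lemma enorm0 {R : realType} {n : nat} : enorm (0 : 'rV[R]_n) = 0.
Proof. by rewrite -(scale0r 0) enormZ normr0 mul0r. Qed.

Lemma norm_le_enorm {R : realType} {n : nat} (v : 'rV[R]_n) : `|v| <= enorm v.
Proof.
apply: mx_norm_le_entries => [|i j]; first exact: enorm_ge0.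
rewrite [i]ord1 -sqrtr_sqr; apply: ler_wsqrtr.
by rewrite (bigD1 j)//= lerDl sumr_ge0// => k _; exact: sqr_ge0.
Qed.

Lemma enorm_le_norm {R : realType} {n : nat} (v : 'rV[R]_n) :
  enorm v <= Num.sqrt n%:R * `|v|.
Proof.
rewrite -[`|v|]ger0_norm// -sqrtr_sqr -sqrtrM//.
apply: ler_wsqrtr; rewrite (@le_trans _ _ (\sum_(i < n) `|v| ^+ 2)) //.
  apply: ler_sum => i _; rewrite -real_normK ?num_real//.
  by rewrite lerXn2r ?nnegrE// mx_entry_le_norm.
by rewrite sumr_const card_ord mulr_natl.
Qed.

Lemma enorm_eq0 {R : realType} {n : nat} (v : 'rV[R]_n) : enorm v = 0 -> v = 0.
Proof. by move=> v0; apply/normr0_eq0/le_anti; rewrite normr_ge0 -v0 norm_le_enorm. Qed.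

Lemma cvg_enorm {R : realType} {T : Type} {F : set_system T} {FF : Filter F}
    {n : nat} {f : T -> 'rV[R]_n} {v : 'rV[R]_n} :
  f @ F --> v -> enorm (f x) @[x --> F] --> enorm v.
Proof.
move=> fv; apply: (continuous_cvg _ (@sqrt_continuous R _)).
apply: cvg_big => [|i _]; first exact: add_continuous.
by apply: cvgM; exact: cvg_entry.
Qed.

Lemma dist_le_enorm {R : realType} {n : nat} {S : set 'rV[R]_n} {y : 'rV[R]_n}
    (x : 'rV[R]_n) : S y -> (dist x S <= (enorm (x - y))%:E)%E.
Proof. by move=> Sy; apply: ereal_inf_lbound; exists y. Qed.

(** The infimum defining the distance need not be attained, hence the slack
    between c and e. *)
Lemma dist_le_witness {R : realType} {n : nat} {S : set 'rV[R]_n} {x : 'rV[R]_n}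
    {c e : R} : (dist x S <= c%:E)%E -> c < e ->
  exists2 y, S y & enorm (x - y) < e.
Proof.
move=> xc ce; have /ereal_inf_lt[_ [y Sy <-]] : (dist x S < e%:E)%E.
  by rewrite (le_lt_trans xc)// lte_fin.
by rewrite lte_fin; exists y.
Qed.

(** * Subregularity along a sequence leaving in direction d *)

(** The angular condition is positively homogeneous in the point, so the factor
    t k can be dropped: it says that u k is almost aligned with d. *)
Lemma near_dir_nbhd {R : realType} {n : nat} {rho delta : R} {t : nat -> R}
    {u : nat -> 'rV[R]_n} {d : 'rV[R]_n} :
  0 < rho -> 0 < delta -> (forall k, 0 < t k) -> t @ \oo --> (0 : R) ->
  u @ \oo --> d -> \forall k \near \oo, dir_nbhd rho delta d (t k *: u k).
Proof.
move=> rho0 delta0 t0 tcvg ucvg.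
have cvg_un : enorm (u k) @[k --> \oo] --> enorm d by exact: cvg_enorm.
have small : \forall k \near \oo, t k * enorm (u k) < rho.
  have : t k * enorm (u k) @[k --> \oo] --> 0 * enorm d
    by exact: (cvgM tcvg cvg_un).
  by rewrite mul0r => /cvgr_lt; apply.
have aligned : \forall k \near \oo,
    enorm (enorm d *: u k - enorm (u k) *: d) <= delta * enorm (u k) * enorm d.
  have [->|d0] := eqVneq d 0.
    (* For d = 0 the directional neighbourhood is a whole ball. *)
    by near=> k; rewrite scaler0 subr0 enorm0 scale0r enorm0 mulr0.
  have : delta * enorm (u k) * enorm d
      - enorm (enorm d *: u k - enorm (u k) *: d) @[k --> \oo]
      --> delta * enorm d * enorm d - enorm (enorm d *: d - enorm d *: d).
    apply: cvgB; first exact: (cvgM (cvgM (cvg_cst _) cvg_un) (cvg_cst _)).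
    apply: cvg_enorm.
    exact: (cvgB (cvgZ (cvg_cst _) ucvg) (cvgZ cvg_un (cvg_cst _))).
  rewrite subrr enorm0 subr0 => /cvgr_gt/(_ 0).
  have ed : 0 < enorm d.
    by rewrite lt_neqAle enorm_ge0 andbT; apply: contra_neq d0 => /esym/enorm_eq0.
  rewrite !mulr_gt0// => /(_ isT).
  by apply: filterS => k; rewrite subr_gt0 => /ltW.
near=> k; split.
  by rewrite enormZ gtr0_norm//; near: k.
rewrite enormZ gtr0_norm//.
have -> : enorm d *: (t k *: u k) - (t k * enorm (u k)) *: d
    = t k *: (enorm d *: u k - enorm (u k) *: d).
  by rewrite scalerBr !scalerA [enorm d * _]mulrC.
rewrite enormZ gtr0_norm//.
rewrite mulrCA -!mulrA ler_wpM2l ?(ltW (t0 k))// mulrA.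
by near: k.
Unshelve. all: by end_near. Qed.

Lemma subregular_witness {R : realType} {n m : nat}
    {g : 'rV[R]_n -> 'rV[R]_m} {Lam : set 'rV[R]_m} {x d : 'rV[R]_n} {kap : R}
    {t : nat -> R} {u : nat -> 'rV[R]_n} {z : nat -> 'rV[R]_m} {s : nat -> R} :
  subregularity_constant g Lam x d kap ->
  (forall k, 0 < t k) -> t @ \oo --> (0 : R) -> u @ \oo --> d ->
  (forall k, Lam (z k)) -> (forall k, 0 < s k) ->
  \forall k \near \oo, exists2 y, feasible_set g Lam y &
    enorm (x + t k *: u k - y) < kap * enorm (g (x + t k *: u k) - z k) + s k.
Proof.
move=> [kap0 [rho [delta [rho0 delta0 reg]]]] t0 tcvg ucvg Lamz s0.
near=> k.
apply: (@dist_le_witness _ _ _ _ (kap * enorm (g (x + t k *: u k) - z k))).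
  rewrite (le_trans (reg _ _))//; first by near: k; exact: near_dir_nbhd.
  by rewrite EFinM lee_pmul2l ?lte_fin ?fin_numE//; exact: dist_le_enorm.
by rewrite ltrDl.
Unshelve. all: by end_near. Qed.

(** * Rescaled increments along curves *)

(** The linear term is subtracted along the moving direction u k, not along d:
    u k - d is only o(1), and t k times it is not negligible against t k ^ 2. *)
Lemma taylor_quotient_cvg {R : realType} {n m : nat} {g : 'rV[R]_n -> 'rV[R]_m}
    {x d : 'rV[R]_n} {t : nat -> R} {u : nat -> 'rV[R]_n} :
  (forall y, differentiable g y) -> differentiable (jacobian g) x ->
  (forall k, 0 < t k) -> t @ \oo --> (0 : R) -> u @ \oo --> d ->
  (t k ^+ 2)^-1 *: (g (x + t k *: u k) - g x - t k *: (u k *m jacobian g x))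
    @[k --> \oo] --> 2^-1 *: (d *m 'd (jacobian g) x d).
Proof.
move=> dg dJ t0 tcvg ucvg.
pose r h := g (x + h) - g x - h *m jacobian g x
  - 2^-1 *: (h *m 'd (jacobian g) x h).
have hcvg : t k *: u k @[k --> \oo] --> (0 : 'rV[R]_n).
  by rewrite -(scale0r d); exact: (cvgZ tcvg ucvg).
have rcvg : (t k ^+ 2)^-1 *: r (t k *: u k) @[k --> \oo] --> (0 : 'rV[R]_m).
  apply/cvgrPdist_le => e e0.
  have D0 : 0 < `|d| + 1 by rewrite ltr_wpDl.
  have := taylor_peano (x := x) (e / (`|d| + 1) ^+ 2) dg dJ.
  rewrite divr_gt0 ?exprn_gt0// => /(_ isT) /hcvg; rewrite nbhs_filterE => rle.
  have ule : \forall k \near \oo, `|u k| < `|d| + 1.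
    by apply: (cvgr_lt `|d|); [exact: cvg_norm | rewrite ltrDl].
  near=> k; rewrite sub0r normrN normrZ.
  rewrite gtr0_norm ?invr_gt0 ?exprn_gt0//.
  rewrite ler_pdivrMl ?exprn_gt0//.
  rewrite (@le_trans _ _ (e / (`|d| + 1) ^+ 2 * `|t k *: u k| ^+ 2))//.
    by near: k.
  rewrite normrZ exprMn gtr0_norm// mulrCA ler_pM2l ?exprn_gt0//.
  rewrite mulrAC ler_pdivrMr ?exprn_gt0// ler_pM2l//.
  rewrite lerXn2r ?nnegrE// ?(ltW D0)//.
  by apply: ltW; near: k.
have -> : (fun k => (t k ^+ 2)^-1 *: (g (x + t k *: u k) - g x
    - t k *: (u k *m jacobian g x)))
  = (fun k => 2^-1 *: (u k *m 'd (jacobian g) x (u k))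
      + (t k ^+ 2)^-1 *: r (t k *: u k)).
  apply/funext => k.
  have dZ : 'd (jacobian g) x (t k *: u k) = t k *: 'd (jacobian g) x (u k).
    by rewrite linearZ.
  rewrite /r dZ -!scalemxAl -scalemxAr.
  move: (u k *m jacobian g x) (u k *m _) (g _ - g x) => A Q G.
  by apply/rowP => i; rewrite !mxE; field; rewrite gt_eqF.
have dcvg : 'd (jacobian g) x (u k) @[k --> \oo] --> 'd (jacobian g) x d.
  have dcont : continuous ('d (jacobian g) x) by exact: diff_continuous.
  by apply: (continuous_cvg _ (dcont d)).
rewrite -[X in _ --> X]addr0.
exact: (cvgD (cvgZ (cvg_cst (2^-1 : R)) (cvg_mulmx ucvg dcvg)) rcvg).
Unshelve. all: by end_near. Qed.

(** The increment is t k times the linear term plus t k ^ 2 times a convergent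
    sequence. *)
Lemma taylor1_cvg {R : realType} {n m : nat} {g : 'rV[R]_n -> 'rV[R]_m}
    {x d : 'rV[R]_n} {t : nat -> R} {u : nat -> 'rV[R]_n} :
  (forall y, differentiable g y) -> differentiable (jacobian g) x ->
  (forall k, 0 < t k) -> t @ \oo --> (0 : R) -> u @ \oo --> d ->
  (t k)^-1 *: (g (x + t k *: u k) - g x) @[k --> \oo] --> grad_app g x d.
Proof.
move=> dg dJ t0 tcvg ucvg.
pose proof (cvgD (cvg_mulmx ucvg (cvg_cst (jacobian g x)))
  (cvgZ tcvg (taylor_quotient_cvg dg dJ t0 tcvg ucvg))) as lim_expansion.
move: lim_expansion; rewrite scale0r addr0.
apply: cvg_trans; apply: near_eq_cvg; near=> k.
rewrite /= !fctE /=.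
move: (u k *m jacobian g x) (g _ - g x) => A G.
by apply/rowP => i; rewrite !mxE; field; rewrite gt_eqF.
Unshelve. all: by end_near. Qed.

(** The parabola is x + t u with u = d + (t / 2) w, and the linear term along u
    contributes t Dg d, which is subtracted, and (t ^ 2 / 2) Dg w, which joins the
    second-order term in the limit. *)
Lemma taylor2_cvg {R : realType} {n m : nat} {g : 'rV[R]_n -> 'rV[R]_m}
    {x d w : 'rV[R]_n} {t : nat -> R} {wk : nat -> 'rV[R]_n} :
  (forall y, differentiable g y) -> differentiable (jacobian g) x ->
  (forall k, 0 < t k) -> t @ \oo --> (0 : R) -> wk @ \oo --> w ->
  (2^-1 * t k ^+ 2)^-1 *: (g (x + t k *: d + (2^-1 * t k ^+ 2) *: wk k)
      - g x - t k *: grad_app g x d) @[k --> \oo]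
    --> grad_app g x w + hess_app g x d.
Proof.
move=> dg dJ t0 tcvg wcvg.
have ucvg : d + (2^-1 * t k) *: wk k @[k --> \oo] --> d.
  rewrite -[X in _ --> X]addr0 -(scale0r w) -(mulr0 2^-1).
  exact: (cvgD (cvg_cst d) (cvgZ (cvgM (cvg_cst (2^-1 : R)) tcvg) wcvg)).
pose proof (cvgD (cvg_mulmx wcvg (cvg_cst (jacobian g x)))
  (cvgZ (cvg_cst (2 : R)) (taylor_quotient_cvg dg dJ t0 tcvg ucvg)))
  as lim_expansion.
move: lim_expansion; rewrite scalerA divff// scale1r -hess_app_diff//.
apply: cvg_trans; apply: near_eq_cvg; near=> k.
rewrite /= !fctE /=.
have -> : x + t k *: (d + (2^-1 * t k) *: wk k)
    = x + t k *: d + (2^-1 * t k ^+ 2) *: wk k.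
  by rewrite scalerDr addrA scalerA mulrCA -expr2.
rewrite mulmxDl -scalemxAl /grad_app.
move: (wk k *m jacobian g x) (d *m jacobian g x) (g _ - g x) => A D G.
by apply/rowP => i; rewrite !mxE; field; rewrite gt_eqF.
Unshelve. all: by end_near. Qed.

(** * Limit directions by compactness *)

(** Where compactness of bounded closed sets enters: a cluster point of the
    approximating directions is a limit direction, and the norm being continuous
    it satisfies the same bound without the slack. *)
Lemma seq_limit_near {R : realType} {n : nat} {P : R -> 'rV[R]_n -> Prop}
    {w : 'rV[R]_n} {c : R} :
  (forall e : R, 0 < e -> exists t u,
    [/\ 0 < t < e, enorm (w - u) < c + e & P t u]) ->
  exists2 v, enorm (w - v) <= c &
    forall e : R, 0 < e -> exists t u, [/\ 0 < t < e, `|v - u| < e & P t u].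
Proof.
move=> H.
have /choice[tv Htv] (k : nat) : exists tu : R * 'rV[R]_n,
    [/\ 0 < tu.1 < k.+1%:R^-1, enorm (w - tu.2) < c + k.+1%:R^-1
      & P tu.1 tu.2].
  have [|t [u tu]] := H k.+1%:R^-1; first by rewrite invr_gt0.
  by exists (t, u).
pose u := snd \o tv.
pose K := [set v | `|w - v| <= c + 1].
have K_compact : compact K.
  apply: bounded_closed_compact.
    exists (`|w| + (c + 1)); split; first exact: num_real.
    move=> M wM v Kv; rewrite /= -[v](subKr w) (le_trans (ler_normB _ _))//.
    by rewrite (le_trans _ (ltW wM))// lerD2l.
  exact: closed_closed_ball_.
have Ku : \forall k \near \oo, K (u k).
  near=> k; rewrite /K /= (le_trans (norm_le_enorm _))//.
  have [_ /ltW wk _] := Htv k.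
  by rewrite (le_trans wk)// lerD2l invf_le1 ?ler1n// ltr0n.
(* A cluster point is enough: it only has to be visited beyond every rank. *)
have [v [_ vcluster]] := K_compact (u @ \oo) _ Ku.
have near_v (e : R) : 0 < e -> exists t v', [/\ 0 < t < e, `|v - v'| < e,
    enorm (w - v) < c + e + e & P t v'].
  move=> e0.
  have late : \forall k \near \oo, k.+1%:R^-1 < e.
    exact: near_infty_natSinv_lt (PosNum e0).
  have : \forall v' \near v, `|v - v'| < e /\ enorm (w - v) < enorm (w - v') + e.
    have vv : v' @[v' --> v] --> v by exact: cvg_id.
    have wv : enorm (w - v') @[v' --> v] --> enorm (w - v).
      exact: (cvg_enorm (cvgB (cvg_cst w) vv)).
    near=> v'; split; first by near: v'; exact: (cvgrPdist_lt _ _).1 vv e e0.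
    rewrite -ltrBlDr; near: v'.
    by apply: (cvgr_gt (enorm (w - v))) => //; rewrite ltrBlDr ltrDl.
  move=> /(vcluster (u @` [set k | k.+1%:R^-1 < e])) [].
    by move: late; apply: filterS => k ke; exists k.
  move=> _ [[k ke <-] [vu wvu]].
  have [/andP[tk0 tke] wk Pk] := Htv k.
  exists (tv k).1, (u k); split => //.
  - by rewrite tk0 (lt_trans tke).
  - by rewrite (lt_le_trans wvu)// lerD2r (le_trans (ltW wk))// lerD2l ltW.
exists v.
  apply/ler_addgt0Pr => e e0.
  have [|t [v' [_ _ /ltW wv _]]] := near_v (e / 2); first by rewrite divr_gt0.
  by rewrite (le_trans wv)// -addrA -splitr.
by move=> e /near_v[t [v' [? ? _ ?]]]; exists t, v'.
Unshelve. all: by end_near. Qed.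

(** * Tangent directions of F and of Lam *)

Lemma tangent_cone_sub {R : realType} {n m : nat} {g : 'rV[R]_n -> 'rV[R]_m}
    {Lam : set 'rV[R]_m} {x d : 'rV[R]_n} :
  (forall y, differentiable g y) -> differentiable (jacobian g) x ->
  tangent_cone (feasible_set g Lam) x d ->
  tangent_cone Lam (g x) (grad_app g x d).
Proof.
move=> dg dJ [t [dk [t0 tcvg dcvg Fk]]].
exists t, (fun k => (t k)^-1 *: (g (x + t k *: dk k) - g x)); split => //.
  exact: taylor1_cvg.
move=> k; rewrite scalerA divff ?gt_eqF// scale1r [g x + _]addrC subrK.
exact: Fk.
Qed.

Lemma tangent_set2_sub {R : realType} {n m : nat} {g : 'rV[R]_n -> 'rV[R]_m}
    {Lam : set 'rV[R]_m} {x d w : 'rV[R]_n} :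
  (forall y, differentiable g y) -> differentiable (jacobian g) x ->
  tangent_set2 (feasible_set g Lam) x d w ->
  tangent_set2 Lam (g x) (grad_app g x d) (grad_app g x w + hess_app g x d).
Proof.
move=> dg dJ [t [wk [t0 tcvg wcvg Fk]]].
exists t, (fun k => (2^-1 * t k ^+ 2)^-1 *:
  (g (x + t k *: d + (2^-1 * t k ^+ 2) *: wk k)
    - g x - t k *: grad_app g x d)); split => //.
  exact: taylor2_cvg.
move=> k; rewrite scalerA divff ?mulf_neq0 ?expf_neq0 ?invr_neq0 ?gt_eqF//.
rewrite scale1r -[_ - g x - _]addrA -opprD [X in Lam X]addrC subrK.
exact: Fk.
Qed.

(** Points of F at distance o(t k) from the ray x + t k d, obtained from the
    points of Lam that realise Dg d, have rescaled increments tending to d. *)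
Lemma tangent_cone_lift {R : realType} {n m : nat} {g : 'rV[R]_n -> 'rV[R]_m}
    {Lam : set 'rV[R]_m} {x d : 'rV[R]_n} {kap : R} :
  (forall y, differentiable g y) -> differentiable (jacobian g) x ->
  subregularity_constant g Lam x d kap ->
  tangent_cone Lam (g x) (grad_app g x d) ->
  tangent_cone (feasible_set g Lam) x d.
Proof.
move=> dg dJ reg [t [zk [t0 tcvg zcvg Lamk]]].
apply/(seq_limit_intro (fun t u => feasible_set g Lam (x + t *: u))) => e e0.
have dcvg : d @[_ --> \oo] --> d by exact: cvg_cst.
(* The slack t k * t k given to the witnesses becomes t k once rescaled. *)
pose err k := kap * enorm ((t k)^-1 *: (g (x + t k *: d) - g x) - zk k) + t k.
have errcvg : err k @[k --> \oo] --> (0 : R).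
  have -> : (0 : R) = kap * enorm (grad_app g x d - grad_app g x d) + 0.
    by rewrite subrr enorm0 mulr0 addr0.
  apply: cvgD => //; apply: cvgM; first exact: cvg_cst.
  exact: (cvg_enorm (cvgB (taylor1_cvg dg dJ t0 tcvg dcvg) zcvg)).
have wit := subregular_witness reg t0 tcvg dcvg Lamk
  (fun k => mulr_gt0 (t0 k) (t0 k)).
near \oo => k.
have [y Fy yk] : exists2 y, feasible_set g Lam y &
    enorm (x + t k *: d - y)
      < kap * enorm (g (x + t k *: d) - (g x + t k *: zk k)) + t k * t k.
  by near: k.
exists (t k), ((t k)^-1 *: (y - x)); split.
- rewrite t0 /=; near: k; exact: (cvgr_lt (0 : R)).
- rewrite (le_lt_trans (norm_le_enorm _))//.
  rewrite (@lt_trans _ _ (err k))//; last by near: k; exact: (cvgr_lt (0 : R)).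
  rewrite -(ltr_pM2l (t0 k)) -{1}[t k]gtr0_norm// -enormZ.
  rewrite scalerBr scalerA divff ?gt_eqF// scale1r opprB addrA [_ + x]addrC.
  rewrite (lt_le_trans yk)// /err mulrDr lerD2r mulrCA.
  rewrite -{3}[t k]gtr0_norm// -enormZ scalerBr scalerA divff ?gt_eqF// scale1r.
  by rewrite opprD addrA.
- by rewrite scalerA divff ?gt_eqF// scale1r [x + _]addrC subrK.
Unshelve. all: by end_near. Qed.

(** The core of the proof: subregularity moves the parabola generated by w onto
    F, and the displacement, rescaled by t ^ 2 / 2, has in the limit at most kap
    times the size of the defect of w with respect to z. *)
Lemma tangent_set2_lift {R : realType} {n m : nat} {g : 'rV[R]_n -> 'rV[R]_m}
    {Lam : set 'rV[R]_m} {x d : 'rV[R]_n} {kap : R} {z : 'rV[R]_m}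
    (w : 'rV[R]_n) :
  (forall y, differentiable g y) -> differentiable (jacobian g) x ->
  subregularity_constant g Lam x d kap ->
  tangent_set2 Lam (g x) (grad_app g x d) z ->
  exists2 v, enorm (w - v) <= kap * enorm (grad_app g x w + hess_app g x d - z) &
    tangent_set2 (feasible_set g Lam) x d v.
Proof.
move=> dg dJ reg [t [zk [t0 tcvg zcvg Lamk]]].
pose c := kap * enorm (grad_app g x w + hess_app g x d - z).
suff [v wv Fv] : exists2 v, enorm (w - v) <= c & forall e : R, 0 < e ->
    exists t u, [/\ 0 < t < e, `|v - u| < e &
      feasible_set g Lam (x + t *: d + (2^-1 * t ^+ 2) *: u)].
  exists v => //; exact/(seq_limit_intro
    (fun t u => feasible_set g Lam (x + t *: d + (2^-1 * t ^+ 2) *: u))).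
apply: seq_limit_near => e e0.
pose s k := 2^-1 * t k ^+ 2.
have s0 k : 0 < s k by rewrite mulr_gt0// exprn_gt0.
have wcvg : w @[_ --> \oo] --> w by exact: cvg_cst.
have ucvg : d + (2^-1 * t k) *: w @[k --> \oo] --> d.
  rewrite -[X in _ --> X]addr0 -(scale0r w) -(mulr0 2^-1).
  exact: (cvgD (cvg_cst d) (cvgZ (cvgM (cvg_cst (2^-1 : R)) tcvg) wcvg)).
have uE k : x + t k *: (d + (2^-1 * t k) *: w) = x + t k *: d + s k *: w.
  by rewrite scalerDr addrA scalerA mulrCA -expr2.
pose Q k := (s k)^-1 *: (g (x + t k *: d + s k *: w) - g x - t k *: grad_app g x d).
pose err k := kap * enorm (Q k - zk k) + t k.
have errcvg : err k @[k --> \oo] --> c.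
  rewrite -[c]addr0; apply: cvgD => //; apply: cvgM; first exact: cvg_cst.
  exact: (cvg_enorm (cvgB (taylor2_cvg dg dJ t0 tcvg wcvg) zcvg)).
have wit := subregular_witness reg t0 tcvg ucvg Lamk
  (fun k => mulr_gt0 (s0 k) (t0 k)).
near \oo => k.
have [y Fy] : exists2 y, feasible_set g Lam y &
    enorm (x + t k *: (d + (2^-1 * t k) *: w) - y)
      < kap * enorm (g (x + t k *: (d + (2^-1 * t k) *: w))
        - (g x + t k *: grad_app g x d + s k *: zk k)) + s k * t k.
  by near: k.
rewrite uE => yk.
have skK : s k * (s k)^-1 = 1 by rewrite divff ?gt_eqF.
exists (t k), ((s k)^-1 *: (y - (x + t k *: d))); split.
- rewrite t0 /=; near: k; exact: (cvgr_lt (0 : R)).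
- rewrite (@lt_trans _ _ (err k))//; last first.
    by near: k; apply: (cvgr_lt c) => //; rewrite ltrDl.
  rewrite -(ltr_pM2l (s0 k)) -{1}[s k]gtr0_norm// -enormZ.
  rewrite scalerBr scalerA skK scale1r opprB addrA [_ + (x + _)]addrC.
  rewrite (lt_le_trans yk)// /err mulrDr lerD2r mulrCA.
  rewrite -{3}[s k]gtr0_norm// -enormZ scalerBr scalerA skK scale1r.
  by rewrite !opprD !addrA.
- by rewrite -/(s k) scalerA skK scale1r addrC subrK.
Unshelve. all: by end_near. Qed.

(** * The estimate with the modulus *)

Lemma dist_fin {R : realType} {n : nat} {S : set 'rV[R]_n} {y : 'rV[R]_n}
    (x : 'rV[R]_n) : S y ->
  exists2 D : R, 0 <= D <= enorm (x - y) & dist x S = D%:E.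
Proof.
move=> Sy; have xS := dist_le_enorm x Sy.
have Sx : (0 <= dist x S)%E.
  by apply: le_ereal_inf_tmp => _ [z _ <-]; rewrite lee_fin enorm_ge0.
have fin : dist x S \is a fin_num.
  by rewrite ge0_fin_numE// (le_lt_trans xS) ?ltry.
by exists (fine (dist x S)); rewrite -?lee_fin fineK// Sx.
Qed.

(** When kap times the Lipschitz constant M of g is below 1/2, the estimate
    dist(v, F) <= kap dist(g v, Lam) <= kap M |v - y|, with y in F almost nearest
    to v, reads dist(v, F) <= dist(v, F) / 2 up to a small error.  Hence
    dist(v, F) = 0 along the ray in direction d. *)
Lemma small_constant_tangent_set2 {R : realType} {n m : nat}
    {g : 'rV[R]_n -> 'rV[R]_m} {Lam : set 'rV[R]_m} {x : 'rV[R]_n}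
    (d : 'rV[R]_n) :
  (forall y, differentiable g y) -> {for x, continuous (jacobian g)} ->
  feasible_set g Lam x ->
  exists2 c : R, 0 < c & forall kap, subregularity_constant g Lam x d kap ->
    kap < c -> tangent_set2 (feasible_set g Lam) x d 0.
Proof.
move=> dg Jc Fx; have [r r0 [L L0 lip]] := locally_lipschitz dg Jc.
pose M := (Num.sqrt m%:R + 1) * L.
have M0 : 0 < M by rewrite mulr_gt0// ltr_wpDl ?sqrtr_ge0.
have elip y z : `|y - x| < r -> `|z - x| < r ->
    enorm (g y - g z) <= M * enorm (y - z).
  move=> yr zr; rewrite (le_trans (enorm_le_norm _))// -mulrA.
  rewrite ler_pM ?sqrtr_ge0 ?lerDl// (le_trans (lip _ _ yr zr))//.
  by rewrite ler_pM2l// norm_le_enorm.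
exists (2 * M)^-1 => [|kap [kap0 [rho [delta [rho0 delta0 reg]]]] kapM].
  by rewrite invr_gt0 mulr_gt0.
have kapM2 : kap * M < 2^-1.
  by rewrite -ltr_pdivlMr// -invfM.
apply/(seq_limit_intro
  (fun t u => feasible_set g Lam (x + t *: d + (2^-1 * t ^+ 2) *: u))) => e e0.
pose t (k : nat) : R := k.+1%:R^-1.
have t0 k : 0 < t k by rewrite invr_gt0.
have tcvg : t @ \oo --> (0 : R).
  apply/cvgrPdist_lt => e' e'0; near=> k.
  rewrite sub0r normrN gtr0_norm//.
  by near: k; exact: (near_infty_natSinv_lt (PosNum e'0)).
have dcvg : d @[_ --> \oo] --> d by exact: cvg_cst.
have lcvg : t k * enorm d @[k --> \oo] --> (0 : R).
  rewrite -(mul0r (enorm d)); exact: (cvgM tcvg (cvg_cst _)).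
near \oo => k.
have tke : t k < e by near: k; exact: (cvgr_lt (0 : R)).
have vE : enorm (t k *: d) < r / 3.
  rewrite enormZ gtr0_norm//; near: k; apply: (cvgr_lt (0 : R)) => //.
  by rewrite divr_gt0.
have {}reg : (dist (x + t k *: d)%R (feasible_set g Lam)
    <= kap%:E * dist (g (x + t k *: d)%R) Lam)%E.
  by apply: reg; near: k; exact: near_dir_nbhd.
have [D] := dist_fin (x + t k *: d) Fx.
rewrite [x + _]addrC addrK => /andP[D0 Dle] DE.
have D_eq0 : D = 0.
  apply/eqP; rewrite eq_le D0 andbT leNgt; apply/negP => Dpos.
  (* A point y that is nearest up to the factor 3/2; it stays within the ball of
     radius r, as |y - x| <= |t d| + (3/2) D < r / 3 + r / 2. *)
  have [||y Fy yD] := @dist_le_witness _ _ (feasible_set g Lam) (t k *: d + x)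
      D (D + D / 2).
  - by rewrite DE.
  - by rewrite ltrDl divr_gt0.
  have yr : `|y - x| < r.
    have -> : y - x = t k *: d - (t k *: d + x - y).
      by apply/rowP => i; rewrite !mxE; ring.
    rewrite (le_lt_trans (ler_normB _ _))//.
    have := norm_le_enorm (t k *: d).
    have := norm_le_enorm (t k *: d + x - y).
    by move: yD vE Dle; lra.
  have xr : `|t k *: d + x - x| < r.
    rewrite addrK (le_lt_trans (norm_le_enorm _))// (lt_trans vE)//.
    by rewrite ltr_pdivrMr// ltr_pMr// ltr1n.
  have : D <= kap * M * (D + D / 2).
    rewrite -lee_fin -DE [t k *: d + x]addrC (le_trans reg)//.
    rewrite -mulrA EFinM lee_pmul2l ?lte_fin ?fin_numE//.
    rewrite (le_trans (@dist_le_enorm _ _ Lam (g y) _ Fy))// lee_fin [x + _]addrC.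
    by rewrite (le_trans (elip _ _ xr yr))// ler_pM2l// ltW.
  apply/negP; rewrite -ltNge.
  rewrite (@lt_le_trans _ _ (2^-1 * (D + D / 2)))//; last by lra.
  by rewrite ltr_pM2r// ltr_wpDr// divr_ge0.
pose s := 2^-1 * t k ^+ 2.
have s0 : 0 < s by rewrite mulr_gt0// exprn_gt0.
have [||y Fy ys] := @dist_le_witness _ _ (feasible_set g Lam) (x + t k *: d)
    0 (s * e).
- by rewrite addrC DE D_eq0.
- by rewrite mulr_gt0.
exists (t k), (s^-1 *: (y - (x + t k *: d))); split.
- by rewrite t0.
- rewrite (le_lt_trans (norm_le_enorm _))// sub0r enormN enormZ.
  rewrite gtr0_norm ?invr_gt0// ltr_pdivrMl//.
  by rewrite -enormN opprB.
- by rewrite -/s scalerA divff ?gt_eqF// scale1r addrC subrK.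
Unshelve. all: by end_near. Qed.

(** The case c = 0 with S empty has to be excluded, as 0 times +oo is 0. *)
Lemma le_mule_dist {R : realType} {n : nat} {S : set 'rV[R]_n} {x : 'rV[R]_n}
    {a : \bar R} {c : R} : 0 <= c -> (c = 0 -> S !=set0) ->
  (forall y, S y -> (a <= (c * enorm (x - y)%R)%:E)%E) ->
  (a <= c%:E * dist x S)%E.
Proof.
rewrite le_eqVlt => /predU1P[<- /(_ erefl)[y Sy] aS|c0 _ aS].
  by rewrite mul0e; have := aS _ Sy; rewrite mul0r.
rewrite -lee_pdivrMl//; apply: le_ereal_inf_tmp => _ [y Sy <-].
by rewrite lee_pdivrMl// -EFinM; exact: aS.
Qed.

Lemma subregularity_modulus_ge0 {R : realType} {n m : nat}
    {g : 'rV[R]_n -> 'rV[R]_m} {Lam : set 'rV[R]_m} {x d : 'rV[R]_n} :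
  metrically_subregular g Lam x d -> 0 <= subregularity_modulus g Lam x d.
Proof. by move=> [k regk]; apply: lb_le_inf; [exists k|move=> c [/ltW]]. Qed.

Lemma subregularity_constant_near_modulus {R : realType} {n m : nat}
    {g : 'rV[R]_n -> 'rV[R]_m} {Lam : set 'rV[R]_m} {x d : 'rV[R]_n} (e : R) :
  metrically_subregular g Lam x d -> 0 < e ->
  exists2 kap, subregularity_constant g Lam x d kap &
    kap < subregularity_modulus g Lam x d + e.
Proof.
move=> [k regk] e0; apply: inf_adherent => //; split; first by exists k.
by exists 0 => c [/ltW].
Qed.

Theorem proposition5 (R : realType) (n m : nat) (g : 'rV[R]_n -> 'rV[R]_m)
    (Lam : set 'rV[R]_m) (xbar d : 'rV[R]_n) (kappa : R)
    (g_C2 : twice_continuously_differentiable g)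
    (Lam_closed : closed Lam)
    (xbar_feasible : feasible_set g Lam xbar)
    (subreg : metrically_subregular g Lam xbar d)
    (kappaE : kappa = subregularity_modulus g Lam xbar d) :
  let F := feasible_set g Lam in
  let T2Lam := tangent_set2 Lam (g xbar) (grad_app g xbar d) in
  (tangent_cone F xbar d
     <-> tangent_cone Lam (g xbar) (grad_app g xbar d)) /\
  (tangent_cone Lam (g xbar) (grad_app g xbar d) ->
    [/\ tangent_set2 F xbar d
          = [set w | T2Lam (grad_app g xbar w + hess_app g xbar d)],
        [set w | T2Lam (grad_app g xbar w + hess_app g xbar d)]
          = setmap_inv (D2M g Lam xbar d) 0 &
        forall w : 'rV[R]_n,
          (dist w (tangent_set2 F xbar d)
             <= kappa%:E * dist (grad_app g xbar w + hess_app g xbar d)%R T2Lam)%E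
          /\ (kappa%:E * dist (grad_app g xbar w + hess_app g xbar d)%R T2Lam
             = kappa%:E * dist 0 (D2M g Lam xbar d w))%E]).
Proof.
move=> F T2Lam; have [dg dJ _] := g_C2; have {}dJ := dJ xbar.
have [k regk] := subreg.
split.
  by split; [exact: tangent_cone_sub|exact: tangent_cone_lift regk].
move=> _; split.
- apply/seteqP; split=> w; first exact: tangent_set2_sub.
  move=> /(tangent_set2_lift w dg dJ regk)[v].
  rewrite subrr enorm0 mulr0 => wv.
  suff -> : w = v by [].
  apply/eqP; rewrite -subr_eq0; apply/eqP/enorm_eq0/le_anti.
  by rewrite wv enorm_ge0.
- apply/seteqP; split=> w /=; first by exists (grad_app g xbar w + hess_app g xbar d); rewrite ?subrr.
  by move=> [z T2z /eqP]; rewrite subr_eq0 => /eqP->.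
move=> w; split.
  apply: le_mule_dist => [|kappa0|z T2z].
  - by rewrite kappaE; exact: subregularity_modulus_ge0.
  - have Jc : {for xbar, continuous (jacobian g)}.
      exact: differentiable_continuous.
    have [c c0 small] := small_constant_tangent_set2 d dg Jc xbar_feasible.
    have [kap regkap] := subregularity_constant_near_modulus _ subreg c0.
    rewrite -kappaE kappa0 add0r => /(small _ regkap) T20.
    exists (grad_app g xbar 0 + hess_app g xbar d); exact: tangent_set2_sub.
  set a := grad_app g xbar w + hess_app g xbar d.
  apply/lee_addgt0Pr => e e0.
  have a0 : 0 < enorm (a - z) + 1 by rewrite ltr_wpDl ?enorm_ge0.
  have [kap regkap kapE] :=
    subregularity_constant_near_modulus _ subreg (divr_gt0 e0 a0).
  have [v wv T2v] := tangent_set2_lift w dg dJ regkap T2z.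
  rewrite (le_trans (dist_le_enorm w T2v))// -EFinD lee_fin (le_trans wv)//.
  rewrite (@le_trans _ _ ((kappa + e / (enorm (a - z) + 1)) * enorm (a - z)))//.
    by rewrite ler_wpM2r ?enorm_ge0// kappaE ltW.
  rewrite mulrDl lerD2l mulrAC ler_pdivrMr// ler_pM2l//.
  by rewrite lerDl.
congr (_ * ereal_inf _)%E; apply/seteqP; split=> _ [z Tz <-].
  exists (grad_app g xbar w + hess_app g xbar d - z); first by exists z.
  by rewrite sub0r enormN.
by case: Tz => y Ty <-; exists y => //; rewrite sub0r enormN.
Qed.
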